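(* Let $d$ and $k$ be integers with $1\leq k\leq d-1$. Then the degree of the vertex $p(U_d^k)$ of the polytope $H_\infty^+(d,1)$, that is, the number of edges of $H_\infty^+(d,1)$ incident to $p(U_d^k)$, is equal to $\displaystyle\binom{d}{k}$.
   Context: $G_d=\{0,1\}^d\setminus\{0\}\subset\mathbb{R}^d$ is the set of the $2^d-1$ non-zero $0/1$-valued $d$-dimensional vectors, called generators. For $S\subseteq G_d$, $p(S)=\sum_{g\in S}g$, with $p(\emptyset)=0$. The White Whale $H_\infty^+(d,1)$ is the zonotope $\mathrm{conv}\{p(S):S\subseteq G_d\}$, i.e. the Minkowski sum of the line segments between the origin and $g$, for $g\in G_d$. For $1\leq k\leq d-1$, $U_d^k$ denotes the set of all $0/1$-valued $d$-dimensional vectors whose last coordinate is equal to $1$ and that have at most $k$ non-zero coordinates. (The point $p(U_d^k)$ is a vertex of $H_\infty^+(d,1)$.) *)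

(* Defs.v *)
From HB Require Import structures.
From mathcomp Require Import all_boot all_order all_algebra.
From mathcomp Require Import all_classical all_reals all_analysis.

Set Implicit Arguments.
Unset Strict Implicit.
Unset Printing Implicit Defensive.

Import Order.TTheory GRing.Theory Num.Theory.

Local Open Scope classical_set_scope.
Local Open Scope ring_scope.

Section Polytopes.
Variables (R : realType) (d : nat).
Local Notation V := 'rV[R]_d.

Definition dotv (c x : V) : R := \sum_(i < d) c 0 i * x 0 i.

Definition conv_hull (A : set V) : set V := smallest (@convex_set R V) A.

Definition affine_hull (A : set V) : set V :=
  [set y | exists (n : nat) (x : 'I_n -> V) (a : 'I_n -> R),
    [/\ forall i, A (x i), \sum_(i < n) a i = 1
      & y = \sum_(i < n) a i *: x i]].

Definition has_affine_dim (A : set V) (m : nat) : Prop :=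
  exists (x : V) (W : {vspace V}),
    affine_hull A = [set x + w | w in [set w | w \in W]] /\ \dim W = m.

(* The empty set and P itself (c = 0) count as faces. *)
Definition is_face (P F : set V) : Prop :=
  exists (c : V) (b : R),
    (forall x, P x -> dotv c x <= b) /\ F = [set x | P x /\ dotv c x = b].

Definition is_vertex (P : set V) (v : V) : Prop := is_face P [set v].

Definition is_edge (P E : set V) : Prop := is_face P E /\ has_affine_dim E 1.

Definition edges_at (P : set V) (v : V) : set (set V) :=
  [set E | is_edge P E /\ E v].

End Polytopes.

(* 0/1-valued vectors are encoded as boolean row vectors, so that sets of them
   are finite sets; vec01 R embeds them in R^d. *)
Definition vec01 (R : realType) (d : nat) (g : 'rV[bool]_d) : 'rV[R]_d :=
  \row_(i < d) (g 0 i)%:R.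

Definition generators (d : nat) : {set 'rV[bool]_d} :=
  [set g | g != const_mx false]%SET.

Definition psum (R : realType) (d : nat) (S : {set 'rV[bool]_d}) : 'rV[R]_d :=
  \sum_(g in S) vec01 R g.

Definition white_whale (R : realType) (d : nat) : set 'rV[R]_d :=
  conv_hull [set psum R S | S in [set S : {set 'rV[bool]_d} | S \subset generators d]].
Arguments white_whale R d : clear implicits.

Definition Uset (d k : nat) : {set 'rV[bool]_d} :=
  [set g : 'rV[bool]_d |
    [exists i : 'I_d, (i.+1 == d) && g ord0 i] &&
    (#|[set i : 'I_d | g ord0 i]%SET| <= k)%N]%SET.

(* Main.v *)
(** Let v = p(S). Writing Z = v + sum_g [0,1] (s_g g), with s_g = -1 if g is in
    S and +1 otherwise, a linear form c supports Z at v iff c (s_g g) <= 0 for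
    all generators g. No two generators are collinear, so the edges at v are
    the segments [v, v + s_g g] for which some such c vanishes on g alone.

    Let S = U_d^k. Such a c satisfies c_i < 0 for every i < d: choose A of size
    k containing d but not i; then c_i = c (A + e_i) - c (A), with A in U and
    A + e_i outside U. Adding or removing a coordinate of g then shows that g
    contains d and has k or k + 1 ones. Conversely [sepv] gives, for each such
    g, a form vanishing on g alone. Deleting d from the supports of size k + 1
    turns these g into the k-subsets of {1, ..., d}. *)
Require Import Defs.
From HB Require Import structures.
From mathcomp Require Import all_boot all_order all_algebra.
From mathcomp Require Import all_classical all_reals all_analysis.
From mathcomp Require Import ring lra zify.

Import Order.TTheory GRing.Theory Num.Theory.

Local Open Scope classical_set_scope.
Local Open Scope card_scope.
Local Open Scope ring_scope.

Section Whale.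
Variables (R : realType) (d : nat).
Implicit Types (S T : {set 'rV[bool]_d}) (g h : 'rV[bool]_d).
Implicit Types (c x y : 'rV[R]_d).
Local Notation gen := (generators d).
Local Notation Z := (white_whale R d).
Local Notation vec := (vec01 R).

(** * Linear forms and 0/1 vectors *)

Lemma dotvD c x y : dotv c (x + y) = dotv c x + dotv c y.
Proof. by rewrite -big_split; apply: eq_bigr => i _; rewrite mxE mulrDr. Qed.

Lemma dotvZ c a x : dotv c (a *: x) = a * dotv c x.
Proof. by rewrite mulr_sumr; apply: eq_bigr => i _; rewrite mxE mulrCA. Qed.

Lemma dotv_sum (I : Type) (r : seq I) (P : pred I) (F : I -> 'rV[R]_d) c :
  dotv c (\sum_(i <- r | P i) F i) = \sum_(i <- r | P i) dotv c (F i).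
Proof.
elim/big_rec2: _ => [|i y x _ <-]; last by rewrite dotvD.
by rewrite /dotv big1 // => i _; rewrite mxE mulr0.
Qed.

Lemma dotv_vec01 c g : dotv c (vec g) = \sum_(i < d | g 0 i) c 0 i.
Proof.
rewrite big_mkcond; apply: eq_bigr => i _; rewrite mxE.
by case: (g 0 i); rewrite ?mulr1 ?mulr0.
Qed.

Lemma genP g : reflect (exists i, g 0 i) (g \in gen).
Proof.
rewrite inE; apply: (iffP idP) => [|[i gi]].
  apply: contra_neqP => /forallNP gF; apply/rowP => i; rewrite mxE.
  by apply/negP/gF.
by apply/eqP => g0; rewrite g0 mxE in gi.
Qed.

Lemma vec01_neq0 g : g \in gen -> vec g != 0.
Proof.
case/genP=> i gi; apply/eqP => /rowP/(_ i); rewrite !mxE gi.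
by move/eqP; rewrite oner_eq0.
Qed.

(** A coordinate where [g] is 1 forces [a = 1], so distinct generators span distinct lines. *)
Lemma vec01_collinear g h (a : R) :
  g \in gen -> vec g = a *: vec h -> g = h.
Proof.
move=> /genP[i gi] /rowP E.
have a1 : a = 1.
  by move: (E i); rewrite !mxE gi; case: (h 0 i); rewrite ?mulr1 ?mulr0 => /eqP;
    rewrite ?oner_eq0 // => /eqP <-.
apply/rowP => j; move: (E j); rewrite !mxE a1 mul1r.
by case: (g 0 j); case: (h 0 j) => // /eqP; rewrite ?oner_eq0 // eq_sym oner_eq0.
Qed.

(** * The zonotope in coordinates measured from [psum R S] *)

Lemma white_whale_psum S : S \subset gen -> Z (psum R S).
Proof. by move=> Sgen; apply: sub_gen_smallest; exists S. Qed.

(** Trades the packaged interval parameter of [convex_set] for a real [t] with explicit bounds. *)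
Lemma convex_setP (A : set 'rV[R]_d) :
  convex_set A <->
  forall x y t, 0 <= t <= 1 -> A x -> A y -> A (t *: x + (1 - t) *: y).
Proof.
split=> cA x y t.
  case/andP=> t0 t1 Ax Ay; have := cA x y (Itv01 t0 t1).
  by rewrite !inE; exact.
by rewrite !inE => Ax Ay; apply: cA => //; rewrite ge0 le1.
Qed.

Lemma white_whale_convex : convex_set Z.
Proof.
apply/convex_setP => x y t t01 Zx Zy A [cA GA].
by move/convex_setP: (cA); apply=> //; [exact: Zx | exact: Zy].
Qed.

(* The coordinate of the segment [0, g] is measured from the endpoint used by
   [psum R S], so that [psum R S] itself has all coordinates zero. *)
Definition dir S g : 'rV[R]_d := (-1) ^+ (g \in S) *: vec g.

Definition edge_of S g : set 'rV[R]_d :=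
  [set psum R S + t *: dir S g | t in [set t | 0 <= t <= 1]].

Lemma psum_shift S T : S \subset gen -> T \subset gen ->
  psum R T = psum R S + \sum_(g in gen) ((g \in S) != (g \in T))%:R *: dir S g.
Proof.
move=> Sgen Tgen.
have E (A : {set 'rV[bool]_d}) : A \subset gen ->
    psum R A = \sum_(g in gen) (g \in A)%:R *: vec g.
  move=> Agen; rewrite /psum big_mkcond [RHS]big_mkcond; apply: eq_bigr => g _.
  have [gA|gA] := boolP (g \in A); first by rewrite (fintype.subsetP Agen) // scale1r.
  by rewrite scale0r if_same.
rewrite (E _ Sgen) (E _ Tgen) -big_split; apply: eq_bigr => g _ /=.
rewrite scalerA -scalerDl; congr (_ *: _).
by case: (g \in S); case: (g \in T) => /=; rewrite ?expr0 ?expr1; lra.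
Qed.

(** The points of this form make up a convex set containing every [psum R T], hence containing [Z],
    the smallest such set. *)
Lemma white_whale_coord S x : S \subset gen -> Z x ->
  exists l : 'rV[bool]_d -> R, (forall g, 0 <= l g <= 1) /\
    x = psum R S + \sum_(g in gen) l g *: dir S g.
Proof.
move=> Sgen; pose A := [set x | exists l : 'rV[bool]_d -> R,
  (forall g, 0 <= l g <= 1) /\ x = psum R S + \sum_(g in gen) l g *: dir S g].
suff: Z `<=` A by exact.
apply: smallest_sub => [|_ [T Tgen <-]]; last first.
  exists (fun g => ((g \in S) != (g \in T))%:R); split; last exact: psum_shift.
  by move=> g; rewrite ler0n lern1 leq_b1.
apply/convex_setP => _ _ t /andP[t0 t1] [l [l01 ->]] [m [m01 ->]].
exists (fun g => t * l g + (1 - t) * m g); split => [g|].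
  have /andP[l0 l1] := l01 g; have /andP[m0 m1] := m01 g.
  have t1' : 0 <= 1 - t by rewrite subr_ge0.
  have tl : t * l g <= t by rewrite ler_piMr.
  have tm : (1 - t) * m g <= 1 - t by rewrite ler_piMr.
  by rewrite addr_ge0 ?mulr_ge0 //=; lra.
rewrite !scalerDr addrACA -scalerDl subrKC scale1r; congr (_ + _).
rewrite !scaler_sumr -big_split; apply: eq_bigr => g _ /=.
by rewrite [RHS]scalerDl -!scalerA.
Qed.

Lemma dotv_dir c S g : dotv c (dir S g) = (-1) ^+ (g \in S) * dotv c (vec g).
Proof. exact: dotvZ. Qed.

(** * Faces cut out by a form maximal at [psum R S] *)

Section Face.
Variables (S : {set 'rV[bool]_d}) (c : 'rV[R]_d).
Hypothesis Sgen : S \subset gen.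
Hypothesis cS : forall g, g \in gen -> dotv c (dir S g) <= 0.

Lemma dotv_white_whale_le x : Z x -> dotv c x <= dotv c (psum R S).
Proof.
case/(white_whale_coord _ _ Sgen)=> l [l01 ->].
rewrite dotvD gerDl dotv_sum; apply: sumr_le0 => g gen_g.
by rewrite dotvZ; have /andP[l0 _] := l01 g; rewrite mulr_ge0_le0 ?cS.
Qed.

(** Equality makes a sum of nonpositive terms vanish, so each term is zero and [l g = 0] wherever
    the form is nonzero on [dir S g]. *)
Lemma dotv_white_whale_eq x : Z x -> dotv c x = dotv c (psum R S) ->
  exists l : 'rV[bool]_d -> R, (forall g, 0 <= l g <= 1) /\
    x = psum R S + \sum_(g in gen | dotv c (dir S g) == 0) l g *: dir S g.
Proof.
case/(white_whale_coord _ _ Sgen)=> l [l01 ->].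
rewrite dotvD => /(canRL (addKr _)); rewrite addNr dotv_sum => E.
exists l; split=> //; congr (_ + _); rewrite big_mkcondr.
apply: eq_bigr => g gen_g; case: ifP => // /negP; case/negP => cg.
have l_ge0 h : h \in gen -> 0 <= - dotv c (l h *: dir S h).
  move=> gen_h; have /andP[l0 _] := l01 h.
  by rewrite dotvZ oppr_ge0 mulr_ge0_le0 ?cS.
have /(psumr_eq0P l_ge0)/(_ g gen_g)/eqP :
    \sum_(h in gen) - dotv c (l h *: dir S h) = 0 by rewrite sumrN E oppr0.
by rewrite oppr_eq0 dotvZ mulf_eq0 (negbTE cg) orbF => /eqP->; rewrite scale0r.
Qed.

End Face.

Lemma vertex_psum S c : S \subset gen ->
  (forall g, g \in gen -> dotv c (dir S g) < 0) -> is_vertex Z (psum R S).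
Proof.
move=> Sgen cS; have cS' g : g \in gen -> dotv c (dir S g) <= 0 by move/cS/ltW.
exists c, (dotv c (psum R S)); split; first exact: dotv_white_whale_le.
apply/seteqP; split=> [x -> | x [Zx /(dotv_white_whale_eq _ _ Sgen cS' _ Zx)]] /=.
  by split=> //; exact: white_whale_psum.
case=> l [_ ->]; rewrite big1 ?addr0 // => g /andP[/cS].
by rewrite lt_neqAle => /andP[/negbTE->].
Qed.

(** * Edges as segments along single generators *)

Lemma psum_edge S g : S \subset gen -> g \in gen -> Z (psum R S + dir S g).
Proof.
(* [T] is [S] with the membership of [g] flipped. *)
move=> Sgen gen_g; pose T := [set h in gen | (h \in S) != (h == g)]%SET.
have Tgen : T \subset gen by apply/fintype.subsetP => h; rewrite inE => /andP[].
have mT h : h \in gen -> ((h \in S) != (h \in T)) = (h == g).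
  by move=> gen_h; rewrite /T finset.in_set gen_h; case: (h \in S); case: (h == g).
suff -> : psum R S + dir S g = psum R T by exact: white_whale_psum.
rewrite (psum_shift S T) // (bigD1 g) //= mT // eqxx scale1r.
rewrite big1 ?addr0 // => h /andP[gen_h /negbTE hg].
by rewrite mT // hg scale0r.
Qed.

Lemma edge_of_white_whale S g : S \subset gen -> g \in gen ->
  edge_of S g `<=` Z.
Proof.
move=> Sgen gen_g _ [t t01 <-].
have /convex_setP/(_ _ _ t t01 (psum_edge S g Sgen gen_g)) := white_whale_convex.
move/(_ _ (white_whale_psum S Sgen)).
by rewrite scalerDr addrAC -scalerDl subrKC scale1r.
Qed.

Lemma face_edge_of S c g : S \subset gen -> g \in gen ->
  (forall h, h \in gen -> dotv c (dir S h) <= 0) ->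
  (forall h, h \in gen -> (dotv c (dir S h) == 0) = (h == g)) ->
  [set x | Z x /\ dotv c x = dotv c (psum R S)] = edge_of S g.
Proof.
move=> Sgen gen_g cS cg; apply/seteqP; split=> [x [Zx]|x Ex].
  move/(dotv_white_whale_eq _ _ Sgen cS _ Zx) => [l [l01 ->]].
  exists (l g); [exact: l01 | congr (_ + _); rewrite (big_pred1 g) // => h /=].
  have [gen_h|] := boolP (h \in gen); first by rewrite cg.
  by move=> /negbTE hn; apply/esym; apply: contraFF hn => /eqP->.
split; first exact: (edge_of_white_whale S g).
case: Ex => t _ <-; rewrite dotvD dotvZ.
by have /eqP-> : dotv c (dir S g) == 0; rewrite ?cg // mulr0 addr0.
Qed.

Lemma dir_neq0 S g : g \in gen -> dir S g != 0.
Proof. by move=> gen_g; rewrite scaler_eq0 signr_eq0 vec01_neq0. Qed.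

Lemma edge_of_dim1 S g : g \in gen -> has_affine_dim (edge_of S g) 1.
Proof.
move=> gen_g; exists (psum R S), <[dir S g]>%VS.
rewrite dim_vline dir_neq0 //; split=> //; apply/seteqP; split=> y.
  move=> [n [x [a [Ex a1 ->]]]].
  have /boolp.choice[t Et] i : exists t, x i = psum R S + t *: dir S g.
    by have [t _ <-] := Ex i; exists t.
  exists ((\sum_i a i * t i) *: dir S g) => /=; first by rewrite memvZ ?memv_line.
  under [RHS]eq_bigr do rewrite Et scalerDr scalerA.
  by rewrite big_split -!scaler_suml a1 scale1r.
move=> [w /= /vlineP[t ->] <-].
(* Affine weights may be negative, so the two endpoints already generate the whole line. *)
exists 2%N, (fun i => if i == ord0 then psum R S else psum R S + dir S g),
  (fun i => if i == ord0 then 1 - t else t); split.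
- move=> i; case: eqP => _; [exists 0 | exists 1]; rewrite /= ?lexx ?ler01 //.
    by rewrite scale0r addr0.
  by rewrite scale1r.
- by rewrite !big_ord_recl big_ord0 /= addr0 subrK.
- rewrite !big_ord_recl big_ord0 /= addr0 scalerDr addrA -scalerDl.
  by rewrite subrK scale1r.
Qed.

(** The far endpoint of the first segment lies on the second, so the two generators are collinear,
    hence equal. *)
Lemma edge_of_inj S g h : g \in gen -> edge_of S g = edge_of S h -> g = h.
Proof.
move=> gen_g E.
have : edge_of S g (psum R S + dir S g).
  by exists 1; rewrite /= ?lexx ?ler01 // scale1r.
rewrite E => -[t _ /addrI /(congr1 ( *:%R ((-1) ^+ (g \in S)))) /esym].
rewrite {1}/dir !scalerA -expr2 sqrr_sign scale1r => /vec01_collinear; exact.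
Qed.

(* An edge at [psum R S] has a one-dimensional direction space containing every
   generator on which its supporting functional vanishes, and such generators
   are pairwise non-collinear. *)
Lemma edge_at_psum S E : S \subset gen -> edges_at Z (psum R S) E ->
  exists c g, [/\ g \in gen, E = edge_of S g,
    forall h, h \in gen -> dotv c (dir S h) <= 0 &
    forall h, h \in gen -> (dotv c (dir S h) == 0) = (h == g)].
Proof.
move=> Sgen [[[c [b [cb EE]]] [x0 [W [aff dimW]]]] Ev].
have cv : dotv c (psum R S) = b by move: Ev; rewrite EE => -[].
have cS h : h \in gen -> dotv c (dir S h) <= 0.
  by move=> gen_h; have := cb _ (psum_edge S h Sgen gen_h); rewrite dotvD -cv gerDl.
have E_aff y : E y -> exists2 w, w \in W & y = x0 + w.
  move=> Ey; have : affine_hull E y.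
    exists 1%N, (fun=> y), (fun=> 1); split=> //; rewrite big_ord1 ?scale1r //.
  by rewrite aff => -[w /= wW <-]; exists w.
have [w0 w0W vw0] := E_aff _ Ev.
have dirW h : h \in gen -> dotv c (dir S h) == 0 -> dir S h \in W.
  move=> gen_h /eqP ch.
  have /E_aff [w wW] : E (psum R S + dir S h).
    by rewrite EE; split; [exact: psum_edge | rewrite dotvD ch addr0].
  by rewrite vw0 -addrA => /addrI /(canRL (addKr _)) ->; rewrite rpredD ?rpredN.
have [g /andP[gen_g cg]|none] := pickP [pred g in gen | dotv c (dir S g) == 0].
  exists c, g; have uniq_g h : h \in gen -> (dotv c (dir S h) == 0) = (h == g).
    move=> gen_h; apply/idP/eqP => [ch|-> //].
    have WE : W = <[dir S g]>%VS.
      apply/esym/eqP; rewrite eqEdim dimW dim_vline dir_neq0 // andbT.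
      by rewrite -memvE dirW.
    have := dirW h gen_h ch; rewrite WE => /vlineP[t].
    move/(congr1 ( *:%R ((-1) ^+ (h \in S)))).
    rewrite /dir !scalerA -expr2 sqrr_sign scale1r => /vec01_collinear; exact.
  by split=> //; rewrite EE -cv (face_edge_of S c g).
(* If the form vanishes on no generator, [E] reduces to the point [psum R S], and [W = 0]
   contradicts its dimension 1. *)
have Esub y : E y -> y = psum R S.
  rewrite EE -cv => -[Zy /(dotv_white_whale_eq _ _ Sgen cS _ Zy)[l [_ ->]]].
  by rewrite big1 ?addr0 // => g; have /= -> := none g.
suff /eqP : W = 0%VS by rewrite -dimv_eq0 dimW.
apply/eqP; rewrite -subv0; apply/subvP => w wW; rewrite memv0.
have hull w' : w' \in W -> x0 + w' = psum R S.
  move=> w'W; have : affine_hull E (x0 + w') by rewrite aff; exists w'.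
  case=> n [x [a [Ex a1 ->]]].
  under eq_bigr do rewrite (Esub _ (Ex _)).
  by rewrite -scaler_suml a1 scale1r.
by have := hull w wW; rewrite -(hull 0 (mem0v _)) => /addrI ->.
Qed.

End Whale.

Section Degree.
Variables (R : realType) (n k : nat).
Hypotheses (k_gt0 : (0 < k)%N) (k_le : (k <= n)%N).
Implicit Types (A B : {set 'I_n.+1}) (c : 'rV[R]_n.+1).
Local Notation gen := (generators n.+1).
Local Notation U := (Uset n.+1 k).
Local Notation Z := (white_whale R n.+1).
Local Notation last := (@ord_max n).

(** * Generators indexed by their supports *)

Definition of_set A : 'rV[bool]_n.+1 := \row_i (i \in A).

Lemma of_set_surj g : exists A, g = of_set A.
Proof.
by exists [set i | g 0 i]%SET; apply/rowP => i; rewrite mxE finset.in_set.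
Qed.

Lemma of_set_inj : injective of_set.
Proof. by move=> A B /rowP AB; apply/setP => i; have := AB i; rewrite !mxE. Qed.

Lemma of_set_gen A : (of_set A \in gen) = (A != finset.set0).
Proof.
apply/genP/set0Pn => -[i Ai]; exists i; by rewrite mxE in Ai *.
Qed.

Lemma of_set_Uset A : (of_set A \in U) = (last \in A) && (#|A| <= k)%N.
Proof.
rewrite finset.in_set; congr (_ && _); last first.
  by congr (_ <= _)%N; apply: eq_card => i; rewrite finset.in_set mxE.
apply/existsP/idP => [[i /andP[/eqP[i_n]]]|Al].
  by rewrite mxE; have -> : i = last by apply/val_inj.
by exists last; rewrite eqxx mxE.
Qed.

Lemma Uset_gen : U \subset gen.
Proof.
apply/fintype.subsetP => g; have [A ->] := of_set_surj g.
by rewrite of_set_Uset of_set_gen => /andP[Al _]; apply/set0Pn; exists last.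
Qed.

(** * Explicit forms for the vertex and its edges *)

Lemma dotv_of_set c A : dotv c (vec01 R (of_set A)) = \sum_(i in A) c 0 i.
Proof. by rewrite dotv_vec01; apply: eq_bigl => i; rewrite mxE. Qed.

(** Each coordinate costs [a], each one outside [B] a further [s], and the last one earns [b]; the
    value on a support depends only on counts. *)
Definition sepv (a s b : R) B : 'rV[R]_n.+1 :=
  \row_i ((i == last)%:R * b - a - s * (i \notin B)%:R).

Lemma dotv_sepv (a s b : R) A B : dotv (sepv a s b B) (vec01 R (of_set A)) =
  (last \in A)%:R * b - a * #|A|%:R - s * #|A :\: B|%:R.
Proof.
rewrite dotv_of_set; under eq_bigr do rewrite mxE.
rewrite !big_split /= !sumrN -mulr_sumr -mulr_suml sumr_const mulr_natr.
congr (_ * _ - _ - _ * _).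
  have [Al|Al] := boolP (last \in A).
    rewrite (bigD1 last) //= eqxx big1 ?addr0 // => i /andP[_ /negbTE-> //].
  by rewrite big1 // => i Ai; case: eqP => // il; rewrite -il Ai in Al.
rewrite -sum1_card natr_sum big_mkcond [RHS]big_mkcond; apply: eq_bigr => i _.
by rewrite finset.in_setD andbC; case: (i \in A); case: (i \in B).
Qed.

Lemma Uset_vertex : is_vertex Z (psum R U).
Proof.
(* If [last] is in [A] the value is [2k + 1 - 2|A|], positive exactly when [|A| <= k] and never 0 by
   parity; otherwise it is [-2|A| < 0]. *)
apply: (@vertex_psum _ _ _ (sepv 2 0 (2 * k%:R + 1) finset.set0)).
  exact: Uset_gen.
move=> g; have [A ->] := of_set_surj g.
rewrite of_set_gen -card_gt0 => A0.
rewrite dotv_dir dotv_sepv of_set_Uset mul0r subr0.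
have A1 : 1 <= #|A|%:R :> R by rewrite ler1n.
case: (last \in A) => /=; last by rewrite expr0; lra.
case: leqP => Ak.
  have : #|A|%:R <= k%:R :> R by rewrite ler_nat.
  by rewrite expr1; lra.
have : k.+1%:R <= #|A|%:R :> R by rewrite ler_nat.
by rewrite -natr1 expr0; lra.
Qed.

Lemma edge_functional B : last \in B -> (k <= #|B| <= k.+1)%N ->
  exists c, forall A, A != finset.set0 -> dotv c (dir R _ U (of_set A)) <= 0 /\
   (dotv c (dir R _ U (of_set A)) == 0) = (A == B).
Proof.
move=> Bl Bk.
(* On A the form takes the value [last in A] (k+1)|B| - (k+1)|A| - s |A \ B|:
   as |A \ B| < |A| when last is in A, the weight k+1 lets |A| decide the sign,
   and s settles the ties |A| = |B|. *)
pose s : R := if (#|B| <= k)%N then -1 else 1.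
exists (sepv k.+1%:R s (k.+1 * #|B|)%:R B) => A; rewrite -card_gt0 => A0.
have AB : (A == B) = (#|A :\: B| == 0)%N && (#|A| == #|B|).
  rewrite cards_eq0 finset.setD_eq0; apply/eqP/andP => [->|[AB /eqP E]].
    by rewrite eqxx fintype.subxx.
  by apply/eqP; rewrite eqEcard AB E leqnn.
have jA : (#|A :\: B| + (last \in A) <= #|A|)%N.
  rewrite -(cardsID B A) addnC leq_add2r; case: (boolP (_ \in _)) => // Al.
  by apply/card_gt0P; exists last; rewrite finset.in_setI Al.
have lAB : last \notin A -> ~~ ((#|A :\: B| == 0)%N && (#|A| == #|B|)).
  by rewrite -AB; apply: contraNneq => ->.
rewrite dotv_dir dotv_sepv of_set_Uset AB.
move: jA A0 Bk lAB; rewrite /s.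
move: #|A :\: B| #|A| #|B| => j m m0 jm m_gt0 /andP[km mk] lAB.
(* Writing the signed value as a difference of naturals moves both its sign and its vanishing to
   [nat]. *)
have sub p q (b : bool) (x : R) : x = p%:R - q%:R -> (p <= q)%N ->
    (p == q) = b -> x <= 0 /\ (x == 0) = b.
  by move=> -> pq <-; rewrite subr_le0 ler_nat pq subr_eq0 eqr_nat.
(* The excess [x = k (q - p)] turns multiplication by [k.+1] into linear facts usable by [lia]. *)
have mul_succ_k p q : (p <= q)%N -> exists x,
    [/\ (k.+1 * q = k.+1 * p + (q - p) + x)%N, (p < q -> k <= x)%N
      & p = q -> x = 0%N].
  move=> pq; exists (k * (q - p))%N; split.
  - by rewrite -addnA -mulSn -mulnDr subnKC.
  - by move=> lt_pq; rewrite leq_pmulr // subn_gt0.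
  - by move=> ->; rewrite subnn muln0.
have [m0E|m0E] : m0 = k \/ m0 = k.+1 by lia.
  rewrite m0E leqnn in lAB *; case: (last \in A) jm lAB => /= jm lAB; last first.
    have [x [xE x_ge x0]] := mul_succ_k 0%N m isT.
    by apply: (sub j (k.+1 * m)%N); [rewrite !natrM; ring | lia | lia].
  case: (leqP m k) => mk'.
    have [x [xE x_ge x0]] := mul_succ_k _ _ mk'.
    by apply: (sub (k.+1 * m)%N (k.+1 * k + j)%N);
      [rewrite natrD !natrM; ring | lia | lia].
  have [x [xE x_ge x0]] := mul_succ_k _ _ (ltnW mk').
  by apply: (sub (k.+1 * k + j)%N (k.+1 * m)%N);
      [rewrite natrD !natrM; ring | lia | lia].
rewrite m0E ltnn in lAB *; case: (last \in A) jm lAB => /= jm lAB; last first.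
  have [x [xE x_ge x0]] := mul_succ_k 0%N m isT.
  by apply: (sub 0%N (k.+1 * m + j)%N);
    [rewrite natrD !natrM; ring | lia | lia].
case: (leqP m k) => mk'.
  have [x [xE x_ge x0]] := mul_succ_k _ _ (leqW mk').
  by apply: (sub (k.+1 * m + j)%N (k.+1 * k.+1)%N);
      [rewrite natrD !natrM; ring | lia | lia].
have [x [xE x_ge x0]] := mul_succ_k _ _ mk'.
by apply: (sub (k.+1 * k.+1)%N (k.+1 * m + j)%N);
      [rewrite natrD !natrM; ring | lia | lia].
Qed.

Lemma card_set_avoiding i : i != last ->
  exists A, [/\ last \in A, i \notin A & #|A| = k].
Proof.
(* Outside [i] and [last] there remain [n - 1] coordinates, enough to choose [k - 1] since
   [k <= n]. *)
move=> il; have : (k.-1 <= #|~: [set i; last]%SET|)%N.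
  have := cardsC [set i; last]%SET; rewrite cards2 il card_ord; lia.
case/card_geqP=> s [us ss sC].
have iE j : j \in s -> (j != i) && (j != last).
  by move/sC; rewrite finset.in_setC finset.in_set2 negb_or.
exists (last |: [set j in s])%SET; rewrite setU11; split=> //.
  by rewrite finset.in_setU1 (negbTE il) finset.in_set; apply/negP => /iE; rewrite eqxx.
rewrite cardsU1 finset.in_set; have -> : last \notin s.
  by apply/negP => /iE; rewrite eqxx andbF.
by rewrite cardsE (card_uniqP us) ss; lia.
Qed.

(** * Supports of the edge directions *)

Lemma edge_support c B : B != finset.set0 ->
  (forall A, A != finset.set0 -> dotv c (dir R _ U (of_set A)) <= 0) ->
  (forall A, A != finset.set0 ->
     (dotv c (dir R _ U (of_set A)) == 0) = (A == B)) ->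
  last \in B /\ (k <= #|B| <= k.+1)%N.
Proof.
move=> B0 cU cB; pose w A := \sum_(i in A) c 0 i.
(* Since [dir] carries the sign -1 exactly on [U], the form is nonnegative on [U], nonpositive off
   it, and zero only at [B]. *)
have wU A : last \in A -> (#|A| <= k)%N -> 0 <= w A ?= iff (A == B).
  move=> Al Ak; have A0 : A != finset.set0 by apply/set0Pn; exists last.
  have := cU A A0; have := cB A A0.
  rewrite dotv_dir dotv_of_set of_set_Uset Al Ak expr1 mulN1r oppr_eq0 oppr_le0.
  by rewrite -/(w A) => <- w0; split; rewrite // eq_sym.
have wUC A : A != finset.set0 -> ~~ ((last \in A) && (#|A| <= k)%N) ->
    w A <= 0 ?= iff (A == B).
  move=> A0 AU; have := cU A A0; have := cB A A0.
  rewrite dotv_dir dotv_of_set of_set_Uset (negbTE AU) expr0 mul1r.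
  by rewrite -/(w A) => <- w0; split.
have c_lt0 i : i != last -> c 0 i < 0.
  move=> il; have [A [Al iA Ak]] := card_set_avoiding i il.
  have Ak1 : #|(i |: A)%SET| = k.+1 by rewrite cardsU1 iA Ak.
  have [wA wAE] := wU A Al (eq_leq Ak).
  have iA0 : (i |: A)%SET != finset.set0 by rewrite -card_gt0 Ak1.
  have [wiA wiAE] : w (i |: A)%SET <= 0 ?= iff ((i |: A)%SET == B).
    by apply: wUC; rewrite // Ak1 ltnn andbF.
  have wE : w (i |: A)%SET = c 0 i + w A by rewrite /w big_setU1.
  rewrite lt_neqAle; apply/andP; split; last by lra.
  (* If [c_i = 0], both [A] and [i |: A] have value 0, so both equal [B], although only one contains
     [i]. *)
  apply/eqP => ci; have /eqP wA0 : w A == 0 by apply/eqP; lra.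
  move: wAE wiAE; rewrite wE ci add0r wA0 eqxx => /esym/eqP AB /esym/eqP iAB.
  by move: iA; rewrite AB -iAB setU11.
have wB : w B = 0.
  have [/andP[Bl Bk]|/(wUC B B0) [_]] := boolP ((last \in B) && (#|B| <= k)%N).
    by have [_] := wU B Bl Bk; rewrite eqxx => /eqP.
  by rewrite eqxx => /eqP.
have Bl : last \in B.
  (* Without [last], [w B] would be a nonempty sum of negative coefficients, yet it is 0. *)
  apply: contraT => Bl; have neg i : i \in B -> c 0 i < 0.
    by move=> iB; apply: c_lt0; apply: contraNneq Bl => <-.
  have [i iB] := set0Pn _ B0; have ci := neg i iB.
  have : \sum_(j in B :\ i) c 0 j <= 0.
    by apply: sumr_le0 => j /setD1P[_ /neg/ltW].
  by move: wB; rewrite /w (big_setD1 i) //=; lra.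
split=> //; apply/andP; split; rewrite leqNgt; apply/negP => Bk.
  (* If [|B| < k], adjoining some [i] stays in [U] but gives the negative value [c_i]. *)
  have [i iB] : exists i, i \notin B.
    have : (0 < #|~: B|)%N by have := cardsC B; rewrite card_ord; lia.
    by case/card_gt0P => i; rewrite finset.in_setC => iB; exists i.
  have il : i != last by apply: contraNneq iB => ->.
  have iBl : last \in (i |: B)%SET by rewrite finset.in_setU1 Bl orbT.
  have iBk : (#|(i |: B)%SET| <= k)%N by rewrite cardsU1 iB.
  have [+ _] := wU _ iBl iBk; rewrite /w big_setU1 //= -/(w B) wB addr0 => ci.
  by have := c_lt0 i il; lra.
(* If [|B| > k + 1], removing some [i] other than [last] stays outside [U] but gives the positive
   value [- c_i]. *)
have [i /setD1P[il iB]] : exists i, i \in (B :\ last)%SET.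
  apply/set0Pn; rewrite -card_gt0; move: Bk; rewrite (cardsD1 last B) Bl.
  by rewrite add1n ltnS => /(leq_ltn_trans (leq0n _)).
have BiE : #|(B :\ i)%SET| = #|B|.-1 by rewrite (cardsD1 i B) iB.
have Bi0 : (B :\ i)%SET != finset.set0 by rewrite -card_gt0 BiE; lia.
have Bik : ~~ ((last \in (B :\ i)%SET) && (#|(B :\ i)%SET| <= k)%N).
  by rewrite BiE negb_and -ltnNge; apply/orP; right; lia.
have [wBi _] := wUC _ Bi0 Bik.
move: wB; rewrite /w (big_setD1 i) //= -/(w _).
by have := c_lt0 i il; lra.
Qed.

(* Removing the last coordinate from the sets of size [k.+1] identifies the
   supports of the edge directions with the [k]-subsets of the coordinates. *)
Lemma edges_at_psumE : edges_at Z (psum R U) =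
  (fun A => edge_of R _ U (of_set (last |: A)%SET)) @`
    [set` [set A : {set 'I_n.+1} | #|A| == k]%SET].
Proof.
apply/seteqP; split=> [E|_ [A /= Ak <-]].
  case/(edge_at_psum _ _ _ _ Uset_gen) => c [g [+ -> cU cg]].
  have [B gE] := of_set_surj g; rewrite {}gE in cg *; rewrite of_set_gen => B0.
  have [|A A0|Bl Bk] := edge_support c B B0.
  - by move=> A; rewrite -of_set_gen; exact: cU.
  - by rewrite cg ?of_set_gen // (inj_eq of_set_inj).
  (* When [|B| = k], [B] is its own preimage, as it already contains [last]; when [|B| = k + 1],
     [last] is deleted. *)
  have [BkE|BkE] := eqVneq #|B| k.
    exists B; first by rewrite /= finset.in_set BkE.
    by congr (edge_of _ _ _ (of_set _)); apply/finset.setUidPr; rewrite finset.sub1set.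
  exists (B :\ last)%SET; last by rewrite finset.setD1K.
  move: Bk BkE; rewrite /= finset.in_set (cardsD1 last B) Bl.
  by move: #|(B :\ last)%SET| => m; lia.
rewrite finset.in_set in Ak.
set B := (last |: A)%SET; have Bl : last \in B by rewrite setU11.
have Bk : (k <= #|B| <= k.+1)%N.
  by rewrite cardsU1 (eqP Ak); case: (last \notin A); lia.
have [c cB] := edge_functional B Bl Bk.
have gB : of_set B \in gen by rewrite of_set_gen; apply/set0Pn; exists last.
split; last by exists 0; rewrite /= ?lexx ?ler01 // scale0r addr0.
split; last exact: edge_of_dim1.
have cU h : h \in gen -> dotv c (dir R _ U h) <= 0.
  by have [C ->] := of_set_surj h; rewrite of_set_gen => /cB[].
exists c, (dotv c (psum R U)); split.
  by move=> x; exact: (dotv_white_whale_le _ _ _ _ Uset_gen).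
apply/esym/face_edge_of => // [|h]; first exact: Uset_gen.
have [C ->] := of_set_surj h; rewrite of_set_gen => /cB[_ ->].
by rewrite (inj_eq of_set_inj).
Qed.

(** * Counting the edges *)

Lemma card_edges_at_psum : edges_at Z (psum R U) #= `I_('C(n.+1, k)).
Proof.
rewrite edges_at_psumE; set D := [set A : {set 'I_n.+1} | #|A| == k]%SET.
apply: (card_eq_trans (inj_card_eq _)).
  move=> A B; rewrite !mem_setE !finset.in_set => /eqP Ak /eqP Bk.
  have gA (C : {set 'I_n.+1}) : of_set (last |: C)%SET \in gen.
    by rewrite of_set_gen; apply/set0Pn; exists last; rewrite setU11.
  move/(edge_of_inj _ _ _ _ _ (gA A))/of_set_inj => AB.
  have /(congr1 (fun C : {set 'I_n.+1} => #|C|)) := AB.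
  (* Comparing sizes shows that [last] belongs to both of [A] and [B] or to neither, so the union
     determines the [k]-subset. *)
  rewrite !cardsU1 Ak Bk => /addIn AlB.
  have [Al|Al] := boolP (last \in A); move: AlB; rewrite ?Al ?(negbTE Al).
    case: (boolP (last \in B)) => // Bl _.
    have lU (C : {set 'I_n.+1}) : last \in C -> (last |: C)%SET = C.
      by move=> Cl; apply/finset.setUidPr; rewrite finset.sub1set.
    by rewrite !lU in AB.
  case: (boolP (last \in B)) => // Bl _.
  by rewrite -(finset.setU1K Al) AB finset.setU1K.
have -> : [set` D] = enum_val @` [set: 'I_#|D|].
  apply/seteqP; split=> [A /= AD|_ [i _ <-]]; last exact: enum_valP.
  by exists (enum_rank_in AD A); rewrite ?enum_rankK_in.
apply: (card_eq_trans (inj_card_eq _)); first by move=> i j _ _; exact: enum_val_inj.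
by rewrite card_draws card_ord; apply: card_esym; exact: card_II.
Qed.

End Degree.

Theorem theorem5p5 (R : realType) (d k : nat)
    (hk1 : (1 <= k)%N) (hkd : (k <= d - 1)%N) :
  is_vertex (white_whale R d) (psum R (Uset d k)) /\
  edges_at (white_whale R d) (psum R (Uset d k)) #= `I_('C(d, k)).
Proof.
(* Truncated subtraction gives [0 - 1 = 0], so [1 <= k] excludes [d = 0]. *)
case: d hkd => [|n]; first by case: k hk1.
rewrite subSS subn0 => k_le_n; split; first exact: Uset_vertex.
exact: card_edges_at_psum.
Qed.
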